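(* Let $m\ge 3$ and $n\ge 3$. The expected value of the number of sinks in a randomly labeled $m\times n$ GIG digraph is $$\frac{mn}{5}+\frac{m+n}{10}+\frac{2}{15}.$$
   Context: The vertex set $V$ is the $m\times n$ integer lattice $\{1,\ldots,m\}\times\{1,\ldots,n\}$. Two vertices are called neighbors if they are at Euclidean distance exactly $1$ in the lattice. For a vertex $V_a$, $N(V_a)$ is the set consisting of $V_a$ and its neighbors. A labeling is a bijection from $V$ to $\{1,\ldots,mn\}$; the label of $V_a$ is denoted $v_a$. The GIG (Greatest Increase Grid) digraph of a labeling is the digraph on $V$ in which $(V_a,V_b)$ is a directed edge if and only if $a\ne b$ and $v_b$ is the maximum of the labels of the vertices in $N(V_a)$. A vertex is a sink if its outdegree is $0$. A randomly labeled $m\times n$ GIG digraph is the GIG digraph of a labeling chosen uniformly at random among all $(mn)!$ labelings. *)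

(* Defs.v *)
From HB Require Import structures.
From mathcomp Require Import all_boot all_order all_algebra.

Set Implicit Arguments.
Unset Strict Implicit.
Unset Printing Implicit Defensive.

Import Order.TTheory GRing.Theory Num.Theory.
Local Open Scope ring_scope.

(* The lattice {1..m} x {1..n} with both coordinates shifted
   down by one; only differences of coordinates matter below. *)
Definition vertex (m n : nat) : finType := ('I_m * 'I_n)%type.

Definition eucl_dist (R : rcfType) (m n : nat) (a b : vertex m n) : R :=
  Num.sqrt (((a.1 : nat)%:R - (b.1 : nat)%:R) ^+ 2 +
            ((a.2 : nat)%:R - (b.2 : nat)%:R) ^+ 2).

Definition neighbor (R : rcfType) (m n : nat) : rel (vertex m n) :=
  fun a b => eucl_dist R a b == 1.

Definition closed_nbhd (R : rcfType) (m n : nat) (a : vertex m n) :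
    {set vertex m n} :=
  a |: [set b | neighbor R a b].

(* Injective and surjective onto 'I_(m * n); the index k stands for the label
   k + 1, see [label]. *)
Definition labelings (m n : nat) : {set {ffun vertex m n -> 'I_(m * n)}} :=
  [set f : {ffun vertex m n -> 'I_(m * n)} |
    injectiveb f && [forall k, exists a, f a == k]].

Definition label (m n : nat) (f : {ffun vertex m n -> 'I_(m * n)})
    (a : vertex m n) : nat := (f a).+1.

Definition gig (R : rcfType) (m n : nat)
    (f : {ffun vertex m n -> 'I_(m * n)}) : rel (vertex m n) :=
  fun a b =>
    (a != b) && (label f b == \max_(c in closed_nbhd R a) label f c)%N.

Definition outdegree (T : finType) (e : rel T) (a : T) : nat :=
  #|[set b | e a b]|.

Definition sinks (T : finType) (e : rel T) : {set T} :=
  [set a | outdegree e a == 0%N].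

Definition uniform_expectation (R : rcfType) (T : finType) (A : {set T})
    (X : T -> R) : R :=
  \sum_(t in A) (#|A|%:R)^-1 * X t.

Lemma labelingsP (m n : nat) (f : {ffun vertex m n -> 'I_(m * n)}) :
  reflect (bijective f) (f \in labelings m n).
Proof.
rewrite inE; apply: (iffP andP) => [[/injectiveP f_inj _]|f_bij].
  by apply: inj_card_bij f_inj _; rewrite card_prod !card_ord.
split; first by apply/injectiveP; apply: bij_inj.
by have [g _ gK] := f_bij; apply/forallP=> k; apply/existsP; exists (g k); rewrite gK.
Qed.

Lemma card_labelings (m n : nat) : #|labelings m n| = (m * n)`!.
Proof.
have cardV : #|vertex m n| = (m * n)%N by rewrite card_prod !card_ord.
have := card_inj_ffuns (vertex m n) 'I_(m * n).
rewrite cardV card_ord ffactnn => <-.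
apply: eq_card => f; rewrite [RHS]inE; apply/labelingsP/injectiveP.
  exact: bij_inj.
by move=> f_inj; apply: inj_card_bij f_inj _; rewrite cardV card_ord.
Qed.

(* Main.v *)
Require Import Defs.
From mathcomp Require Import all_boot all_order all_algebra.
From mathcomp Require Import perm zify ring.

Set Implicit Arguments.
Unset Strict Implicit.

Import GRing.Theory Num.Theory.
Local Open Scope ring_scope.

(** A vertex is a sink exactly when its label is the largest one on its closed
    neighbourhood.  Swapping two labels is a bijection on labelings, so each
    vertex of that neighbourhood is equally likely to carry the largest label,
    and the vertex [a] is a sink with probability [1 / #|closed_nbhd a|].  By
    linearity of expectation it remains to sum these reciprocals: a
    neighbourhood has 3, 4 or 5 elements at a corner, on a side, or inside. *)

Definition maximal_on (m n : nat) (A : {set vertex m n}) (a : vertex m n)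
    (f : {ffun vertex m n -> 'I_(m * n)}) : bool :=
  [forall c in A, (f c <= f a)%N].

(** The maximum over the neighbourhood is attained at some [b], and [b] distinct from [a] would give
    an edge. Conversely, an edge from a maximal [a] would lead to a vertex with the same label as
    [a], against injectivity. *)
Lemma mem_sinks_gig (R : rcfType) (m n : nat)
    (f : {ffun vertex m n -> 'I_(m * n)}) (a : vertex m n) :
  f \in labelings m n ->
  (a \in sinks (gig R f)) = maximal_on (closed_nbhd R a) a f.
Proof.
move=> /labelingsP /bij_inj f_inj.
have aN : a \in closed_nbhd R a by rewrite inE set11.
rewrite inE /outdegree cards_eq0; apply/eqP/'forall_implyP => [no_edge c cN|max_a].
  have N_gt0 : (0 < #|closed_nbhd R a|)%N by apply/card_gt0P; exists a.
  have [b bN maxE] := eq_bigmax_cond (label f) N_gt0.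
  have := leq_bigmax_cond _ (F := label f) cN; rewrite maxE /label ltnS.
  case: (eqVneq a b) => [<- //|a_neq_b _].
  by have := in_set0 b; rewrite -no_edge inE /gig a_neq_b maxE eqxx.
apply/setP => b; rewrite in_set0 inE; apply/negP => /andP[/eqP a_neq_b /eqP maxE].
apply/a_neq_b/f_inj/val_inj/eqP; rewrite -eqSS eqn_leq -/(label f b) maxE.
by rewrite (leq_bigmax_cond _ (F := label f) aN); apply/bigmax_leqP => c /max_a.
Qed.

Definition swap_labels (m n : nat) (a b : vertex m n)
    (f : {ffun vertex m n -> 'I_(m * n)}) : {ffun vertex m n -> 'I_(m * n)} :=
  [ffun c => f (tperm a b c)].

Lemma swap_labelsK (m n : nat) (a b : vertex m n) :
  involutive (swap_labels a b).
Proof. by move=> f; apply/ffunP => c; rewrite !ffunE tpermK. Qed.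

Lemma swap_labels_labelings (m n : nat) (a b : vertex m n)
    (f : {ffun vertex m n -> 'I_(m * n)}) :
  f \in labelings m n -> swap_labels a b f \in labelings m n.
Proof.
move=> /labelingsP f_bij; apply/labelingsP.
apply: (eq_bij (bij_comp f_bij (inv_bij (tpermK a b)))).
by move=> c; rewrite ffunE.
Qed.

(** The transposition of [a] and [b] maps [A] to itself and hands the label of [a] to [b]. *)
Lemma maximal_on_swap (m n : nat) (A : {set vertex m n}) (a b : vertex m n)
    (f : {ffun vertex m n -> 'I_(m * n)}) :
  a \in A -> b \in A -> maximal_on A a f -> maximal_on A b (swap_labels a b f).
Proof.
move=> aA bA /'forall_implyP max_a; apply/'forall_implyP => c cA.
by rewrite !ffunE tpermR; apply: max_a; case: tpermP.
Qed.

(** Swapping labels injects the first set into the second; exchanging [a] and [b] then yields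
    equality. *)
Lemma card_maximal_on_leq (m n : nat) (A : {set vertex m n}) (a b : vertex m n) :
  a \in A -> b \in A ->
  (#|[set f in labelings m n | maximal_on A a f]| <=
   #|[set f in labelings m n | maximal_on A b f]|)%N.
Proof.
move=> aA bA; rewrite -(card_imset _ (inv_inj (swap_labelsK a b))).
apply: subset_leq_card; apply/subsetP => _ /imsetP[f + ->].
rewrite inE => /andP[fL max_a].
by rewrite inE swap_labels_labelings // maximal_on_swap.
Qed.

Lemma sum_maximal_on (m n : nat) (A : {set vertex m n}) (a : vertex m n)
    (f : {ffun vertex m n -> 'I_(m * n)}) :
  a \in A -> f \in labelings m n -> (\sum_(b in A) maximal_on A b f = 1)%N.
Proof.
move=> aA /labelingsP /bij_inj f_inj.
case: (@arg_maxnP _ a [in A] (fun c => f c : nat) aA) => b bA max_b.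
rewrite (bigD1 b) //= big1 => [|c /andP[cA c_neq_b]].
  by rewrite addn0; apply/eqP; rewrite eqb1; apply/'forall_implyP.
apply/eqP; rewrite eqb0; apply: contra c_neq_b => /'forall_implyP max_c.
by apply/eqP/f_inj/val_inj/anti_leq/andP; split; [exact: max_b | exact: max_c].
Qed.

(** Double counting of the pairs of a labeling [f] and a vertex [b] of [A] maximal for [f]: each [f]
    has exactly one such [b], and each [b] has as many [f] as [a] has. *)
Lemma card_maximal_on (m n : nat) (A : {set vertex m n}) (a : vertex m n) :
  a \in A ->
  (#|A| * #|[set f in labelings m n | maximal_on A a f]| = #|labelings m n|)%N.
Proof.
move=> aA; rewrite -[RHS]sum1_card.
transitivity (\sum_(f in labelings m n) \sum_(b in A) maximal_on A b f)%N; last first.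
  by apply: eq_bigr => f fL; rewrite (sum_maximal_on aA).
rewrite exchange_big /= -sum_nat_const; apply: eq_bigr => b bA.
transitivity #|[set f in labelings m n | maximal_on A b f]|.
  by apply/eqP; rewrite eqn_leq !card_maximal_on_leq.
rewrite -sum1_card big_mkcond [RHS]big_mkcond; apply: eq_bigr => f _.
by rewrite inE; case: (f \in _); case: maximal_on.
Qed.

(** Neighbours in the path on [n] vertices; the lattice is the Cartesian product of two paths. *)
Definition path_nbrs (n : nat) (i : 'I_n) : {set 'I_n} :=
  [set j : 'I_n | (i == j.+1 :> nat) || (j == i.+1 :> nat)].

Lemma card_path_nbrs (n : nat) (i : 'I_n) :
  #|path_nbrs i| = ((0 < i) + (i.+1 < n))%N.
Proof.
have card_at (k : nat) : #|[set j : 'I_n | (j : nat) == k]| = (k < n)%N.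
  case: ltnP => [k_lt|k_ge].
    by rewrite -[RHS](cards1 (Ordinal k_lt)); apply: eq_card => j; rewrite !inE.
  by apply: eq_card0 => j; rewrite !inE; have := ltn_ord j; lia.
(* The test on [i] is needed because [0.-1] is [0], which would make [0] its own neighbour. *)
have -> : path_nbrs i =
    (if (0 < i)%N then [set j : 'I_n | (j : nat) == i.-1] else set0)
    :|: [set j : 'I_n | (j : nat) == i.+1].
  by apply/setP => j; rewrite !inE; case: ifP => i0; rewrite !inE; lia.
rewrite cardsU disjoint_setI0 ?cards0 ?subn0 ?card_at; last first.
  rewrite -setI_eq0; apply/eqP/setP => j; rewrite !inE.
  by case: ifP => i0; rewrite !inE; lia.
congr addn; case: ifP => i0; rewrite ?cards0 // card_at.
by have := ltn_ord i; lia.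
Qed.

Lemma neighborE (R : rcfType) (m n : nat) (a b : vertex m n) :
  neighbor R a b = (a.1 == b.1) && (b.2 \in path_nbrs a.2)
                || (b.1 \in path_nbrs a.1) && (a.2 == b.2).
Proof.
rewrite /neighbor /eucl_dist -[X in _ == X]sqrtr1 eqr_sqrt ?ler01 ?addr_ge0 ?sqr_ge0 //.
(* The squared distance is an integer, so the equation descends from [R] to the integers: two
   squares sum to 1 only as 0 and 1. *)
rewrite !pmulrn -!intrB -!rmorphXn -rmorphD /= (eqr_int R _ 1) !inE -!val_eqE /=.
move: (nat_of_ord a.1) (nat_of_ord b.1) (nat_of_ord a.2) (nat_of_ord b.2) => i k j l.
by apply/eqP/idP; nia.
Qed.

(** Putting [a] itself into the first product only keeps the union disjoint, so that cardinals
    add. *)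
Lemma closed_nbhdE (R : rcfType) (m n : nat) (a : vertex m n) :
  closed_nbhd R a = setX [set a.1] (a.2 |: path_nbrs a.2)
                    :|: setX (path_nbrs a.1) [set a.2].
Proof.
apply/setP => -[b1 b2]; rewrite in_setU1 inE neighborE !in_setU !in_setX in_setU1 !in_set1.
rewrite -pair_eqE /= (eq_sym a.1) (eq_sym a.2).
by case: (b1 == a.1); case: (b2 == a.2); rewrite ?orbT ?orbF.
Qed.

Lemma card_closed_nbhd (R : rcfType) (m n : nat) (a : vertex m n) :
  #|closed_nbhd R a| = (#|path_nbrs a.1| + #|path_nbrs a.2|).+1.
Proof.
have path_irr k (i : 'I_k) : i \notin path_nbrs i by rewrite inE; lia.
rewrite closed_nbhdE cardsU disjoint_setI0 ?cards0 ?subn0; last first.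
  rewrite -setI_eq0; apply/eqP/setP => -[b1 b2]; rewrite in_setI !in_setX in_set1 in_set0.
  by case: eqP => // ->; rewrite (negPf (path_irr _ _)) /= andbF.
by rewrite !cardsX !cards1 cardsU1 path_irr muln1 mul1n -addnA add1n addnC.
Qed.

(** The two distinct endpoints of the path have one neighbour each, the inner vertices two. *)
Lemma sum_path_nbrs (R : comRingType) (n : nat) (F : nat -> R) : (2 <= n)%N ->
  \sum_(i < n) F #|path_nbrs i| = F 1%N * 2 + F 2%N * (n%:R - 2).
Proof.
case: n => [|[|n]] // _.
rewrite big_ord_recl big_ord_recr /= !card_path_nbrs /= ltnn.
rewrite (eq_bigr (fun=> F 2%N)) => [|i _].
  by rewrite sumr_const card_ord -mulr_natr -addn2 natrD; ring.
by congr F; rewrite card_path_nbrs /= /bump; have := ltn_ord i; lia.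
Qed.

Theorem theorem3p2 (R : rcfType) (m n : nat) (hm : (3 <= m)%N) (hn : (3 <= n)%N) :
  uniform_expectation (labelings m n)
    (fun f => #|sinks (gig R f)|%:R : R)
  = m%:R * n%:R / 5 + (m%:R + n%:R) / 10 + 2 / 15.
Proof.
have L_neq0 : #|labelings m n|%:R != 0 :> R.
  by rewrite card_labelings pnatr_eq0 -lt0n fact_gt0.
rewrite /uniform_expectation -mulr_sumr -natr_sum.
(* Linearity of expectation: count the pairs of a labeling and one of its sinks by vertex. *)
have -> : (\sum_(f in labelings m n) #|sinks (gig R f)| =
    \sum_(a : vertex m n) #|[set f in labelings m n | maximal_on (closed_nbhd R a) a f]|)%N.
  under eq_bigr do rewrite -sum1_card big_mkcond.
  rewrite exchange_big; apply: eq_bigr => a _ /=.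
  rewrite -sum1_card big_mkcond [RHS]big_mkcond; apply: eq_bigr => f _.
  by rewrite inE; case: ifP => // fL; rewrite (mem_sinks_gig R _ fL).
rewrite natr_sum mulr_sumr.
rewrite (eq_bigr (fun a : vertex m n =>
    (#|path_nbrs a.1| + #|path_nbrs a.2|).+1%:R^-1 : R)) => [|a _]; last first.
  have aN : a \in closed_nbhd R a by rewrite inE set11.
  have := card_maximal_on aN; rewrite card_closed_nbhd => cardE.
  move: L_neq0; rewrite -cardE natrM mulf_eq0 negb_or => /andP[d_neq0 k_neq0].
  by rewrite invfM mulfVK.
rewrite -(pair_bigA _ (fun i j => (#|path_nbrs i| + #|path_nbrs j|).+1%:R^-1)) /=.
(* The inner sum depends on [i] only through its number [d] of path neighbours, so the path formula
   applies to the outer sum, then to [G 1] and [G 2]. *)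
pose G d : R := \sum_(j < n) (d + #|path_nbrs j|).+1%:R^-1.
rewrite (sum_path_nbrs G) ?(ltnW hm) // /G.
rewrite !(sum_path_nbrs (fun d => (_ + d).+1%:R^-1)) ?(ltnW hn) //=.
by field.
Qed.
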